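(* Let $\eta\ge 1$, $l\ge 1$ and $k>1$ be integers, and let $G=W'(\eta,k,l)$ be a generalized windmill graph of Type I. Then for every integer $q\ge 0$, $$Z_q(G)=Z(G)=\eta (k-1)+l.$$
   Context: Graphs are finite, simple and undirected. The generalized windmill graph of Type I, $W'(\eta,k,l)$, consists of $\eta$ disjoint copies of the complete graph $K_k$ (with no edges between different copies) together with $l$ central vertices, where every central vertex is adjacent to every vertex of every copy of $K_k$, and the $l$ central vertices are pairwise adjacent (they form a clique $K_l$). The $q$-analogue of zero forcing ($Z_q$ game), for a fixed integer $q\ge 0$, is a game between a player and an oracle on a graph $G$. Initially all vertices are unfilled. The player repeatedly uses the following rules. Rule 1: fill any vertex at the cost of one token. Rule 2 (forcing rule): at no cost, a filled vertex with a unique unfilled neighbor forces that neighbor to be filled. Rule 3: let $F$ be the set of filled vertices and let $U_1,\dots,U_r$ be the connected components of $G[V\setminus F]$; if $r>q$, the player selects at least $q+1$ of the components $U_i$; the oracle then chooses a nonempty subset $\{U_{i_1},\dots,U_{i_s}\}$ of the selected components; the player may then, at no cost, apply the forcing rule in the subgraph of $G$ induced by $F\cup U_{i_1}\cup\dots\cup U_{i_s}$. The number $Z_q(G)$ is the minimum number of tokens with which the player can guarantee to fill all vertices of $G$, against an oracle trying to maximize the number of tokens spent. The zero forcing number $Z(G)$ is the minimum number of tokens needed to fill all vertices of $G$ when only Rules 1 and 2 are allowed. *)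

(* Defs.v *)
From mathcomp Require Import all_boot.
From mathcomp Require Import boolp.

Set Implicit Arguments.
Unset Strict Implicit.
Unset Printing Implicit Defensive.

Record sgraph := SGraph {
  svertex :> finType;
  sedge : rel svertex;
  sedge_sym : symmetric sedge;
  sedge_irrefl : irreflexive sedge }.

Section ZeroForcing.
Variable G : sgraph.
Implicit Types (A F : {set G}) (S T : {set {set G}}) (u v x y : G).

Definition induced A : rel G :=
  [rel x y | [&& x \in A, y \in A & sedge x y]].

(* The vertex sets of the connected components of G[A]. *)
Definition components A : {set {set G}} :=
  equivalence_partition (connect (induced A)) A.

(* In G[A], with filled set F, the vertex v is the only unfilled neighbor of
   the filled vertex u. *)
Definition forces A F u v : bool :=
  [&& u \in A, u \in F & [set w in A :\: F | sedge u w] == [set v]].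

Definition force_step A : rel {set G} :=
  [rel F F' | [exists u, exists v, forces A F u v && (F' == v |: F)]].

(* [zf_wins F t]: with filled set F and t tokens left, the player can fill
   every vertex using Rules 1 and 2 only. *)
Inductive zf_wins : {set G} -> nat -> Prop :=
| ZfDone t : zf_wins setT t
| ZfFill F t v : v \notin F -> zf_wins (v |: F) t -> zf_wins F t.+1
| ZfForce F t u v : forces setT F u v -> zf_wins (v |: F) t -> zf_wins F t.

(* [zq_wins q F t]: with filled set F and t tokens left, the player can
   guarantee to fill every vertex in the Z_q game.  In [ZqOracle], S is the
   selection of the player, T ranges over the possible answers of the oracle,
   and [reply T] is the filled set the player moves to after the answer T, by
   any number of forces in the subgraph induced by F and the components in T.
   Being inductive, the predicate requires every play to end. *)
Inductive zq_wins (q : nat) : {set G} -> nat -> Prop :=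
| ZqDone t : zq_wins q setT t
| ZqFill F t v : v \notin F -> zq_wins q (v |: F) t -> zq_wins q F t.+1
| ZqForce F t u v :
    forces setT F u v -> zq_wins q (v |: F) t -> zq_wins q F t
| ZqOracle F t S (reply : {set {set G}} -> {set G}) :
    S \subset components (~: F) -> q < #|S| ->
    (forall T, T \subset S -> T != set0 ->
       connect (force_step (F :|: cover T)) F (reply T)) ->
    (forall T, T \subset S -> T != set0 -> zq_wins q (reply T) t) ->
    zq_wins q F t.

Lemma zf_wins_card F : zf_wins F #|~: F|.
Proof.
have [n] := ubnP #|~: F|; elim: n F => // n IHn F ltFn.
have [F0|[v vF]] := set_0Vmem (~: F).
  by rewrite -(setCK F) F0 setC0; exact: ZfDone.
have cF : #|~: F| = #|~: (v |: F)|.+1.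
  by rewrite (cardsD1 v) vF setCU setDE setIC.
rewrite cF; apply: (@ZfFill _ _ v); first by rewrite -in_setC.
by apply: IHn; rewrite cF ltnS in ltFn.
Qed.

Lemma zf_wins_zq_wins q F t : zf_wins F t -> zq_wins q F t.
Proof.
elim=> [{}t | {}F {}t v vF _ IH | {}F {}t u v fuv _ IH].
- exact: ZqDone.
- exact: ZqFill vF IH.
- exact: ZqForce fuv IH.
Qed.

Lemma zf_wins_ex : exists t, `[< zf_wins set0 t >].
Proof. by exists #|~: (set0 : {set G})|; apply/asboolP; apply: zf_wins_card. Qed.

Lemma zq_wins_ex q : exists t, `[< zq_wins q set0 t >].
Proof.
exists #|~: (set0 : {set G})|; apply/asboolP.
by apply: zf_wins_zq_wins; apply: zf_wins_card.
Qed.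

End ZeroForcing.

Definition zero_forcing_number (G : sgraph) : nat := ex_minn (zf_wins_ex G).

Definition Zq (q : nat) (G : sgraph) : nat := ex_minn (zq_wins_ex G q).

Section Windmill.
Variables eta k l : nat.

(* [inl (i, a)] is the vertex a of the i-th copy of K_k, and [inr c] is a
   central vertex. *)
Definition windmill_vertex : finType := (('I_eta * 'I_k) + 'I_l)%type.

Definition windmill_adj : rel windmill_vertex := fun x y =>
  match x, y with
  | inl (i, a), inl (j, b) => (i == j) && (a != b)
  | inr c, inr d => c != d
  | _, _ => true
  end.

Lemma windmill_adj_sym : symmetric windmill_adj.
Proof.
move=> [[i a]|c] [[j b]|d] //=; last by rewrite eq_sym.
by rewrite (eq_sym i) (eq_sym a).
Qed.

Lemma windmill_adj_irrefl : irreflexive windmill_adj.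
Proof. by move=> [[i a]|c] /=; rewrite !eqxx. Qed.

Definition windmill : sgraph := SGraph windmill_adj_sym windmill_adj_irrefl.

End Windmill.

(* Main.v *)
Require Import Defs.
From mathcomp Require Import all_boot.
From mathcomp Require Import boolp zify.

Set Implicit Arguments.
Unset Strict Implicit.
Unset Printing Implicit Defensive.

(** Write N = eta * (k - 1) + l.  Since a player of the Z_q game may ignore
    Rule 3, Z_q <= Z, so it suffices to prove Z <= N and N <= Z_q.

    For Z <= N, buy the centre and all but one vertex of every copy of K_k;
    as k > 1, each copy has a filled vertex, all of whose neighbours but the
    missing one are filled, so it forces the missing one ([zf_wins_start]).

    For N <= Z_q, the quantity [deficit F] is a potential that is N on the
    empty set and 0 at the end, that a token lowers by at most one
    ([deficit_fill]) and that a force, even one made under Rule 3, never lowers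
    ([deficit_force]).  A copy with j unfilled vertices must still pay for
    j - 1 of them, since its last vertex can be forced, and each unfilled
    central vertex costs one token, except that the last of them can be forced
    for free by a vertex of an entirely filled copy.

    Rule 3 gives nothing more because F together with some components of its
    complement is closed under adjacency between unfilled vertices
    ([unfilled_closed_components]).  While a central vertex is unfilled, the
    unfilled vertices form one component, so Rule 3 is Rule 2; once the centre
    is filled, the unfilled part of a copy is a clique, hence is kept or
    discarded as a whole, and only its last vertex can be forced. *)

(** * Zero forcing on an arbitrary graph *)

Section Potential.
Variable G : sgraph.
Implicit Types (A B F : {set G}) (T : {set {set G}}).

(** What survives of Rule 3 in the lower bound: A is the part of the graph in
    which the player may force. *)
Definition unfilled_closed A F :=
  forall x y, x \notin F -> y \notin F -> sedge x y -> x \in A -> y \in A.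

Lemma unfilled_closedS A F F' :
  F \subset F' -> unfilled_closed A F -> unfilled_closed A F'.
Proof.
move=> sFF' clA x y xF yF; apply: clA; [move: xF | move: yF];
  by apply: contraNN; apply: (subsetP sFF').
Qed.

Lemma components_edge A U x y :
  U \in components A -> x \in U -> y \in A -> sedge x y -> y \in U.
Proof.
case/imsetP=> z zA ->; rewrite !inE => /andP[xA zx] yA xy; rewrite yA /=.
by apply: connect_trans zx (connect1 _); apply/and3P.
Qed.

(** A component meeting an edge between unfilled vertices contains the whole
    edge, so the answer of the oracle never separates the two ends. *)
Lemma unfilled_closed_components F T :
  T \subset components (~: F) -> unfilled_closed (F :|: cover T) F.
Proof.
move=> /subsetP sT x y xF yF xy; rewrite !inE (negPf xF) (negPf yF) /=.
case/bigcupP=> U TU Ux; apply/bigcupP; exists U => //.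
by apply: components_edge (sT _ TU) Ux _ xy; rewrite inE.
Qed.

(** The oracle answers with the whole selection S of the player.  The forces
    that follow then take place in the fixed set A made of F and the components
    in S, which stays closed as F grows, so none of them lowers phi. *)
Lemma zq_wins_lower_bound (phi : {set G} -> nat) (q : nat) F t :
    phi setT = 0 ->
    (forall F v, v \notin F -> phi F <= (phi (v |: F)).+1) ->
    (forall A F u v, unfilled_closed A F -> forces A F u v ->
       phi F <= phi (v |: F)) ->
  zq_wins q F t -> phi F <= t.
Proof.
move=> phiT phi_fill phi_force; elim=> {F t}.
- by move=> t; rewrite phiT.
- by move=> F t v vF _ IH; apply: leq_trans (phi_fill F v vF) _.
- move=> F t u v fuv _; apply: leq_trans; apply: phi_force fuv => x y _ _ _ _.
  by rewrite inE.
move=> F t S reply sS qS Hreply _ IH.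
have S0 : S != set0 by rewrite -card_gt0; apply: leq_ltn_trans qS.
apply: leq_trans (IH S (subxx _) S0).
have := Hreply S (subxx _) S0; have := unfilled_closed_components sS.
move: (F :|: cover S) => A clA /connectP[p + ->] {IH Hreply}.
elim: p F clA {sS} => //= F' p IHp F clA.
case/andP=> /existsP[u /existsP[v /andP[fuv /eqP->]]] /IHp IH.
apply: leq_trans (phi_force _ _ _ _ clA fuv) (IH _).
exact: unfilled_closedS (subsetUr _ _) clA.
Qed.

Lemma zf_wins_fill B F t :
  F \subset B -> zf_wins B t -> zf_wins F (#|B :\: F| + t).
Proof.
move=> sFB winB; have [n] := ubnP #|B :\: F|.
elim: n F sFB => // n IHn F sFB lt_n.
have [BF0 | [v vBF]] := set_0Vmem (B :\: F).
  suff -> : F = B by rewrite setDv cards0.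
  by apply/eqP; rewrite eqEsubset sFB -setD_eq0 BF0 eqxx.
move: (vBF); rewrite inE => /andP[vF vB].
have cBF : #|B :\: F| = #|B :\: (v |: F)|.+1.
  by rewrite (cardsD1 v) vBF setDDl setUC.
rewrite cBF addSn; apply: ZfFill vF _; apply: IHn.
  by rewrite subUset sub1set vB.
by rewrite cBF ltnS in lt_n.
Qed.

End Potential.

(** * The windmill *)

Section Windmill.
Variables eta k l : nat.
Let W := windmill eta k l.
Implicit Types (A F : {set W}) (u v : W) (i : 'I_eta) (a : 'I_k) (c : 'I_l).

Definition blade i a : W := inl (i, a).
Definition hub c : W := inr c.

Definition blade_unfilled F i := [set a | blade i a \notin F].
Definition hub_unfilled F := [set c | hub c \notin F].
Definition some_blade_full F := [exists i, blade_unfilled F i == set0].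

(** A lower bound for the number of tokens still needed from F.  Truncated
    subtraction cancels the discount for a full copy of K_k once the centre is
    filled, when there is no central vertex left to force. *)
Definition deficit F :=
  \sum_i #|blade_unfilled F i|.-1 + (#|hub_unfilled F| - some_blade_full F).

Lemma blade_unfilledU_hub F c i :
  blade_unfilled (hub c |: F) i = blade_unfilled F i.
Proof. by apply/setP=> a; rewrite !inE. Qed.

Lemma hub_unfilledU_hub F c : hub_unfilled (hub c |: F) = hub_unfilled F :\ c.
Proof. by apply/setP=> d; rewrite !inE negb_or. Qed.

Lemma blade_unfilledU_blade F i a j :
  blade_unfilled (blade i a |: F) j =
    if j == i then blade_unfilled F i :\ a else blade_unfilled F j.
Proof.
apply/setP=> b; rewrite !inE negb_or.
have [-> | ji] := eqVneq j i; rewrite !inE.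
  by congr (~~ _ && _); apply/eqP/eqP=> [[] | ->].
have -> : (blade j b == blade i a) = false.
  by apply/eqP=> -[E _]; rewrite E eqxx in ji.
by [].
Qed.

Lemma hub_unfilledU_blade F i a :
  hub_unfilled (blade i a |: F) = hub_unfilled F.
Proof. by apply/setP=> d; rewrite !inE. Qed.

Lemma deficitT : deficit setT = 0.
Proof.
rewrite /deficit.
have -> : hub_unfilled setT = set0 by apply/setP=> c; rewrite !inE.
rewrite cards0 sub0n addn0 big1 // => i _.
have -> : blade_unfilled setT i = set0 by apply/setP=> a; rewrite !inE.
by rewrite cards0.
Qed.

Lemma deficit0 : 0 < k -> deficit set0 = eta * k.-1 + l.
Proof.
move=> k_gt0; have bT i : blade_unfilled set0 i = setT.
  by apply/setP=> a; rewrite !inE.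
have -> : deficit set0 = \sum_(i < eta) k.-1 + (l - some_blade_full set0).
  congr (_ + (_ - _)); last first.
    by rewrite -[RHS]card_ord -cardsT; congr #|pred_of_set _|;
       apply/setP=> c; rewrite !inE.
  by apply: eq_bigr => i _; rewrite bT cardsT card_ord.
have -> : some_blade_full set0 = false.
  apply/existsP=> -[i]; rewrite bT -cards_eq0 cardsT card_ord.
  by rewrite eqn0Ngt k_gt0.
by rewrite sum_nat_const card_ord subn0.
Qed.

Lemma some_blade_fullU F i a : 1 < #|blade_unfilled F i| ->
  some_blade_full (blade i a |: F) -> some_blade_full F.
Proof.
move=> gt1 /existsP[j]; rewrite blade_unfilledU_blade.
case: (eqVneq j i) => [_ | _ j0]; last by apply/existsP; exists j.
by rewrite -cards_eq0; move: gt1; rewrite (cardsD1 a); case: (_ \in _); lia.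
Qed.

Lemma sum_blades_unfilledU F i a : a \in blade_unfilled F i ->
  \sum_j #|blade_unfilled F j|.-1 =
  \sum_j #|blade_unfilled (blade i a |: F) j|.-1 + (1 < #|blade_unfilled F i|).
Proof.
move=> ai; rewrite (bigD1 i) //= [in RHS](bigD1 i) //=.
rewrite blade_unfilledU_blade eqxx (cardsD1 a (blade_unfilled F i)) ai.
rewrite [in RHS](eq_bigr (fun j => #|blade_unfilled F j|.-1)).
  by case: #|_ :\ a| => /= *; lia.
by move=> j /negPf ji; rewrite blade_unfilledU_blade ji.
Qed.

Lemma some_blade_fullU_hub F c :
  some_blade_full (hub c |: F) = some_blade_full F.
Proof. by apply: eq_existsb => i; rewrite blade_unfilledU_hub. Qed.

Lemma sum_blades_unfilledU_hub F c :
  \sum_i #|blade_unfilled (hub c |: F) i|.-1 = \sum_i #|blade_unfilled F i|.-1.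
Proof. by apply: eq_bigr => i _; rewrite blade_unfilledU_hub. Qed.

Lemma deficit_fill F v : v \notin F -> deficit F <= (deficit (v |: F)).+1.
Proof.
rewrite /deficit; case: v => [[i a] | c] vF; last first.
  rewrite sum_blades_unfilledU_hub some_blade_fullU_hub hub_unfilledU_hub.
  have cF : c \in hub_unfilled F by rewrite inE.
  by rewrite (cardsD1 c (hub_unfilled F)) cF; lia.
have ai : a \in blade_unfilled F i by rewrite inE.
rewrite hub_unfilledU_blade (sum_blades_unfilledU ai) -/(blade i a).
(* The fill lowers the contribution of the copy or creates the discount for a
   full copy, but not both. *)
have := @some_blade_fullU F i a; case: (1 < _) => [/(_ isT) | _]; last by lia.
by case: (some_blade_full (_ |: _)) => [/(_ isT) -> | _]; lia.
Qed.

Lemma forces_mem A F u v : forces A F u v -> [/\ v \in A, v \notin F & u \in F].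
Proof.
case/and3P=> _ uF /eqP/setP/(_ v); rewrite !inE eqxx.
by case/andP=> /andP[].
Qed.

Lemma forces_uniq A F u v w :
  forces A F u v -> w \in A -> w \notin F -> sedge u w -> w = v.
Proof.
case/and3P=> _ _ /eqP/setP/(_ w) + wA wF uw.
by rewrite !inE wA wF uw => /esym/eqP.
Qed.

(** If the centre is not filled, the unfilled vertices are connected, so A
    contains all of them.  The forcing vertex sees every unfilled central vertex,
    so the forced vertex is the last of these.  A forcing vertex in a copy sees
    the rest of that copy, which is therefore full; a central one sees every
    copy, and eta > 0 provides one. *)
Lemma forces_hub A F u v c : 0 < eta -> unfilled_closed A F ->
  forces A F u v -> hub c \notin F ->
  [/\ v = hub c, hub_unfilled F = [set c] & some_blade_full F].
Proof.
move=> eta_gt0 clA fuv cF; have [vA vF uF] := forces_mem fuv.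
have neq_u (w : W) : w \notin F -> u != w by apply: contraNneq => <-.
have cA : hub c \in A.
  case: (eqVneq v (hub c)) => [<- // | vc]; apply: (clA _ _ vF cF _ vA).
  by case: v vc {fuv vF vA} => [[]|].
have unfA w : w \notin F -> w \in A.
  move=> wF; case: (eqVneq w (hub c)) => [-> // | wc].
  apply: (clA _ _ cF wF _ cA).
  by case: w wc wF => [[]|] //= d; rewrite eq_sym.
have uhub d : hub d \notin F -> sedge u (hub d).
  by move/neq_u; case: u {fuv uF neq_u} => [[]|].
have forced w (wF : w \notin F) := forces_uniq fuv (unfA w wF) wF.
have vc : v = hub c by rewrite (forced _ cF (uhub c cF)).
split=> //.
  apply/setP=> d; rewrite !inE; apply/idP/eqP=> [dF | -> //].
  by have := forced _ dF (uhub d dF); rewrite vc => -[].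
have no_blade i a : blade i a <> v by rewrite vc.
case: u {fuv uF uhub} neq_u forced => [[i b] | d] neq_u forced;
  apply/existsP; [exists i | exists (Ordinal eta_gt0)];
  apply/set0Pn=> -[a]; rewrite inE => aF; apply: no_blade (forced _ aF _) => //=.
by rewrite eqxx; apply: contraNneq (neq_u _ aF) => ->.
Qed.

(** If the centre is filled, the unfilled vertices of a copy form a clique, all
    seen by the forcing vertex, so only the last one of them can be forced. *)
Lemma forces_blade A F u v : unfilled_closed A F -> forces A F u v ->
  hub_unfilled F = set0 ->
  exists i a, v = blade i a /\ blade_unfilled F i = [set a].
Proof.
move=> clA fuv /setP hF; have [vA vF uF] := forces_mem fuv.
case: v fuv vA vF => [[i a] | c] fuv vA vF; last first.
  by have := hF c; rewrite !inE vF.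
exists i, a; split=> //; apply/setP=> b; rewrite !inE.
apply/idP/eqP=> [bF | -> //]; apply/eqP; apply: contraT => ba.
have bA : blade i b \in A.
  by apply: (clA _ _ vF bF _ vA); rewrite /= eqxx eq_sym.
have uv : sedge u (blade i a).
  case/and3P: fuv => _ _ /eqP/setP/(_ (blade i a)).
  by rewrite !inE eqxx => /andP[].
have ub : sedge u (blade i b).
  case: u {fuv} uF uv => [[j d] | d] //= uF /andP[/eqP ji _].
  by rewrite ji eqxx /=; apply: contraNneq bF => <-; rewrite -ji.
by have [/eqP] := forces_uniq fuv bA bF ub; rewrite (negPf ba).
Qed.

Lemma deficit_force A F u v : 0 < eta -> unfilled_closed A F ->
  forces A F u v -> deficit F <= deficit (v |: F).
Proof.
move=> eta_gt0 clA fuv; have [h0 | [c]] := set_0Vmem (hub_unfilled F).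
  have [i [a [-> ui]]] := forces_blade clA fuv h0.
  have ai : a \in blade_unfilled F i by rewrite ui set11.
  rewrite /deficit hub_unfilledU_blade h0 cards0 (sum_blades_unfilledU ai).
  by rewrite ui cards1 !sub0n !addn0.
rewrite inE => cF; have [-> h1 full] := forces_hub eta_gt0 clA fuv cF.
rewrite /deficit sum_blades_unfilledU_hub h1 cards1 full subnn addn0.
exact: leq_addr.
Qed.

Lemma zq_wins_windmill q t : 0 < eta -> 0 < k ->
  zq_wins (G := W) q set0 t -> eta * k.-1 + l <= t.
Proof.
move=> eta_gt0 k_gt0; rewrite -deficit0 //.
apply: zq_wins_lower_bound deficitT deficit_fill _ => A F u v.
exact: deficit_force.
Qed.

Section Start.
Hypothesis k_gt1 : 1 < k.

Let a0 : 'I_k := Ordinal (ltnW k_gt1).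
Let a1 : 'I_k := Ordinal k_gt1.

Definition start : {set W} := ~: [set blade i a0 | i : 'I_eta].

Lemma card_start : #|start| = eta * k.-1 + l.
Proof.
have := cardsC start; rewrite setCK card_imset; last by move=> i j [].
rewrite card_sum card_prod !card_ord => E.
apply/eqP; rewrite -(eqn_add2r eta) E; apply/eqP.
by case: k k_gt1 => // k' _ /=; rewrite mulnS; lia.
Qed.

(** The vertex a1 of a copy forces a0, the only vertex of the copy that can be
   unfilled. *)
Lemma zf_wins_start F : start \subset F -> zf_wins F 0.
Proof.
have [n] := ubnP #|~: F|; elim: n F => // n IHn F lt_n sF.
have [F0 | [v vF]] := set_0Vmem (~: F).
  by rewrite -(setCK F) F0 setC0; exact: ZfDone.
have unf w : w \notin F -> exists i, w = blade i a0.
  move=> wF; suff /imsetP[i _ ->] : w \in [set blade i a0 | i : 'I_eta].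
    by exists i.
  by rewrite -[_ \in _]negbK -in_setC; apply: contraNN wF; apply: (subsetP sF).
have vF' : v \notin F by rewrite -in_setC.
have [i vi] := unf _ vF'.
apply: (@ZfForce _ _ _ (blade i a1) v).
  apply/and3P; split; first by rewrite inE.
    by apply: contraT => /unf[j] [].
  apply/eqP/setP=> w; rewrite !inE andbT.
  apply/andP/eqP=> [[/unf[j ->] /= /andP[/eqP <- _]] | ->]; first by rewrite vi.
  by rewrite vF' vi /= eqxx.
apply: IHn; last exact: subset_trans sF (subsetUr _ _).
by move: lt_n; rewrite (cardsD1 v (~: F)) vF setCU setDE setIC ltnS.
Qed.

Lemma zf_wins_windmill : zf_wins (set0 : {set W}) (eta * k.-1 + l).
Proof.
rewrite -card_start; have := zf_wins_start (subxx start).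
by move/(zf_wins_fill (sub0set start)); rewrite setD0 addn0.
Qed.

End Start.
End Windmill.

Theorem theorem4p2 (eta k l : nat) (heta : 1 <= eta) (hl : 1 <= l)
    (hk : 1 < k) (q : nat) :
  Zq q (windmill eta k l) = zero_forcing_number (windmill eta k l) /\
  zero_forcing_number (windmill eta k l) = eta * (k - 1) + l.
Proof.
have zfw := zf_wins_windmill eta l hk.
have low t := zq_wins_windmill (q := q) (t := t) (l := l) heta (ltnW hk).
have eqZ : zero_forcing_number (windmill eta k l) = eta * k.-1 + l.
  rewrite /zero_forcing_number; case: ex_minnP => n /asboolP wn min_n.
  apply/eqP; rewrite eqn_leq (min_n _ (introT (asboolP _) zfw)).
  exact: low (zf_wins_zq_wins q wn).
rewrite eqZ subn1; split=> //.
rewrite /Zq; case: ex_minnP => n /asboolP wn min_n.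
apply/eqP; rewrite eqn_leq (low _ wn) andbT.
by apply: min_n; apply/asboolP; apply: zf_wins_zq_wins.
Qed.
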